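(* Let $m\ge n\ge 1$ be integers and let $G=K_{m,n}$ be the complete bipartite graph on the vertex set $\{1,\ldots,m\}\cup\{m+1,\ldots,m+n\}$. Then the initial ideal $\mathrm{in}_<(J_G)$ of the binomial edge ideal $J_G$ has linear quotients.
   Context: Let $K$ be a field and $S=K[x_1,\ldots,x_{m+n},y_1,\ldots,y_{m+n}]$, with $<$ the lexicographic order on $S$ induced by $x_1>\cdots>x_{m+n}>y_1>\cdots>y_{m+n}$. The edges of $K_{m,n}$ are all pairs $\{i,j\}$ with $1\le i\le m$ and $m+1\le j\le m+n$. The binomial edge ideal $J_G\subset S$ of a simple graph $G$ is generated by the binomials $x_iy_j-x_jy_i$ with $\{i,j\}\in E(G)$, $i<j$; $\mathrm{in}_<(J_G)$ is its initial ideal with respect to $<$. A monomial ideal has linear quotients if its minimal monomial generators can be ordered as $u_1,\ldots,u_r$ so that for every $\ell$ with $1<\ell\le r$ the ideal quotient $(u_1,\ldots,u_{\ell-1}):(u_\ell)$ is generated by variables. *)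

(* Defs.v *)
From HB Require Import structures.
From mathcomp Require Import all_boot all_order all_algebra.
From mathcomp Require Export mpoly.

Set Implicit Arguments.
Unset Strict Implicit.
Unset Printing Implicit Defensive.

Import Order.TTheory GRing.Theory.
Local Open Scope ring_scope.

(* Ideals of a commutative ring R are predicates R -> Prop, compared
   extensionally. *)
Definition ideal_gen (R : comNzRingType) (G : R -> Prop) (f : R) : Prop :=
  exists s : seq (R * R),
    (forall q, q \in s -> G q.2) /\ f = \sum_(q <- s) q.1 * q.2.

Definition ideal_eq (R : comNzRingType) (I J : R -> Prop) : Prop :=
  forall f, I f <-> J f.

Definition ideal_quotient (R : comNzRingType) (I J : R -> Prop) (f : R) : Prop :=
  forall g, J g -> I (f * g).

Definition monomial_ideal (K : fieldType) (d : nat) (us : seq 'X_{1..d}) :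
    {mpoly K[d]} -> Prop :=
  ideal_gen (fun g => exists2 u, u \in us & g = 'X_[u]).
Arguments monomial_ideal K {d} us _.

(* Lexicographic comparison of exponent vectors, index 0 first: this is the
   lexicographic monomial order with 'X_0 > 'X_1 > ... > 'X_(d-1).  The default
   order on 'X_{1..d} is graded and thus differs. *)
Definition mnm_lex (d : nat) (a b : 'X_{1..d}) : bool :=
  ((multinom_val a : d.-tuplelexi nat) < multinom_val b)%O.

Lemma mnm_lexP (d : nat) (a b : 'X_{1..d}) :
  reflect (exists2 i : 'I_d, (forall j : 'I_d, (j < i)%N -> a j = b j)
                           & (a i < b i)%N)
          (mnm_lex a b).
Proof.
apply: (iffP ltxi_tuplePlt).
- by case=> i h lt_i; exists i => // j /h.
- by case=> i h lt_i; exists i => // j /h.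
Qed.

Definition is_lead_mnm (K : fieldType) (d : nat)
    (f : {mpoly K[d]}) (a : 'X_{1..d}) : Prop :=
  a \in msupp f /\ forall b, b \in msupp f -> b != a -> mnm_lex b a.

Definition initial_ideal (K : fieldType) (d : nat) (I : {mpoly K[d]} -> Prop) :
    {mpoly K[d]} -> Prop :=
  ideal_gen (fun g => exists f a, [/\ I f, is_lead_mnm f a & g = 'X_[a]]).

Definition minimal_monomial_generators (K : fieldType) (d : nat)
    (I : {mpoly K[d]} -> Prop) (us : seq 'X_{1..d}) : Prop :=
  [/\ uniq us, ideal_eq I (monomial_ideal K us)
    & forall u, u \in us -> ~ ideal_eq I (monomial_ideal K (rem u us))].

Definition generated_by_variables (K : fieldType) (d : nat)
    (I : {mpoly K[d]} -> Prop) : Prop :=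
  exists V : {set 'I_d},
    ideal_eq I (ideal_gen (fun g => exists2 i, i \in V & g = 'X_i)).

(* With 0-based l, nth _ us l is u_(l+1) and take l us is u_1, ..., u_l. *)
Definition has_linear_quotients (K : fieldType) (d : nat)
    (I : {mpoly K[d]} -> Prop) : Prop :=
  exists2 us : seq 'X_{1..d}, minimal_monomial_generators I us
    & forall l, (0 < l < size us)%N ->
        generated_by_variables
          (ideal_quotient (monomial_ideal K (take l us))
                          (monomial_ideal K [:: nth 0%MM us l])).

Record simple_graph (N : nat) := SimpleGraph {
  adj :> rel 'I_N;
  adj_sym : ssrbool.symmetric adj;
  adj_irr : irreflexive adj }.

(* S = K[x_1..x_N, y_1..y_N]: the first N variables are the x's, the last N
   the y's, all indices being shifted to start from 0. *)
Definition xvar (K : fieldType) (N : nat) (i : 'I_N) : {mpoly K[N + N]} :=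
  'X_(lshift N i).
Definition yvar (K : fieldType) (N : nat) (i : 'I_N) : {mpoly K[N + N]} :=
  'X_(rshift N i).
Arguments xvar K {N} i.
Arguments yvar K {N} i.

Definition binomial_edge_ideal (K : fieldType) (N : nat) (G : simple_graph N) :
    {mpoly K[N + N]} -> Prop :=
  ideal_gen (fun g => exists i j : 'I_N, [/\ G i j, (i < j)%N
    & g = xvar K i * yvar K j - xvar K j * yvar K i]).
Arguments binomial_edge_ideal K {N} G _.

Definition bipartite_adj (m n : nat) : rel 'I_(m + n) :=
  fun i j => (i < m <= j)%N || (j < m <= i)%N.

Lemma bipartite_adj_sym m n : ssrbool.symmetric (@bipartite_adj m n).
Proof. by move=> i j; rewrite /bipartite_adj orbC. Qed.

Lemma bipartite_adj_irr m n : irreflexive (@bipartite_adj m n).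
Proof. by move=> i; rewrite /bipartite_adj orbb; case: ltngtP. Qed.

Definition complete_bipartite (m n : nat) : simple_graph (m + n) :=
  SimpleGraph (@bipartite_adj_sym m n) (@bipartite_adj_irr m n).

(* Main.v *)
Require Import Defs.
From mathcomp Require Import all_boot all_algebra.
From HB Require Import structures.
From mathcomp Require Import order ring zify.

(** The initial ideal is computed explicitly, and its generators are then put
    in an order with linear quotients.

    Write L for the vertices 1..m and R for the remaining ones.  The initial
    ideal of J is generated by the monomials
      x_i y_j      with i in L and j in R,
      x_i x_k y_j  with i < j in L and k in R,
      x_i y_j y_k  with i < j in R and k in L,
    one for each admissible path of the graph ([initial_ideal_path_mnms]).
    That they are leading monomials is a three-term relation between 2-minors.
    For the converse no S-pair is computed.  Instead, two of the ideals
    containing J are used, in the form of two properties of every f in J: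
    - each monomial of f involves a vertex of L and a vertex of R, since the
      generators have this property ([binomial_edge_mixed]);
    - f is killed by the substitution x_i -> s t_i, y_i -> t_i
      ([binomial_edge_segre]).  Monomials with the same image have the same
      degree in each vertex and the same total x-degree, and the lex smallest of
      them is the only one not divisible by any x_i y_j with i < j.  The
      leading monomial of f cannot be alone in its fibre, for its coefficient
      would survive, so it is divisible by some x_i y_j with i < j
      ([segre_kernel_lead]).
    When i and j lie on opposite sides, x_i y_j is one of the generators;
    otherwise a variable at a vertex of the other side, which exists by the first
    property, completes or replaces one of x_i, y_j to give a generator.

    The generators are ordered by increasing degree and, within a degree, by
    decreasing lex order.  The quotients are linear by an exchange argument:
    if v comes before u, some variable p with larger exponent in v than in u
    satisfies p u in (w) for a generator w before u.  When v and u have the same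
    shape, p is the first variable where they differ, and w arises from u by
    replacing with p a later variable of the same kind; this makes w lex larger
    automatically.  When the shapes differ, a quadratic w = x_i y_j divides p u.
    The criterion is [has_linear_quotients_exchange], the combinatorics is
    [path_mnm_exchange]. *)

Set Implicit Arguments.
Unset Strict Implicit.
Unset Printing Implicit Defensive.

Import Order.TTheory GRing.Theory.
Local Open Scope ring_scope.

(** * Monomial ideals and linear quotients *)

Section MonomialIdeals.
Variables (K : fieldType) (d : nat).
Implicit Types (P : 'X_{1..d} -> Prop) (f g : {mpoly K[d]}).
Implicit Types (u v w a b : 'X_{1..d}) (us : seq 'X_{1..d}).

Lemma lem_mdeg_eq u w :
  (w <= u)%MM -> (mdeg u <= mdeg w)%N -> w = u.
Proof.
move=> le_wu; rewrite -(submK le_wu) mdegD -{2}[mdeg w]add0n leq_add2r leqn0.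
by rewrite mdeg_eq0 => /eqP->; rewrite add0m.
Qed.

Lemma lem_addU (p : 'I_d) a u :
  (u <= a)%MM -> u p = 0%N -> (0 < a p)%N -> (u + U_(p) <= a)%MM.
Proof.
move=> /mnm_lepP le_ua up ap; apply/mnm_lepP => r; rewrite mnmDE mnm1E.
by case: eqP => [<-|_]; rewrite ?up ?addn0.
Qed.

(** Membership in an ideal generated by monomials is decided on the support:
    this reduces every ideal-theoretic claim below to divisibility of exponents. *)
Lemma ideal_gen_msuppP P f :
  ideal_gen (fun g => exists2 u, P u & g = 'X_[u]) f <->
  forall b, b \in msupp f -> exists2 u, P u & (u <= b)%MM.
Proof.
split=> [[s [Ps ->]] b /msupp_sum_le /flattenP[_ /mapP[q + ->]]|H].
  rewrite mem_filter /= => /Ps[u Pu ->] /msuppM_le /allpairsP[[c c'] /= [_]].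
  by rewrite msuppX inE => /eqP-> ->; exists u => //; apply: lem_addl.
suff [s [Ps Es]] : exists s : seq ({mpoly K[d]} * {mpoly K[d]}),
    (forall q, q \in s -> exists2 u, P u & q.2 = 'X_[u]) /\
    \sum_(b <- msupp f) f@_b *: 'X_[b] = \sum_(q <- s) q.1 * q.2.
  by exists s; split=> //; rewrite -Es -mpolyE.
elim: (msupp f) H => [_|b r IH H]; first by exists [::]; rewrite !big_nil.
have [|s [Ps Es]] := IH; first by move=> c cr; apply: H; rewrite inE cr orbT.
have [u Pu le_ub] := H b (mem_head _ _).
exists ((f@_b *: 'X_[(b - u)%MM], 'X_[u]) :: s); split=> [q|].
  by rewrite inE => /predU1P[->|/Ps //]; exists u.
by rewrite !big_cons Es /= -scalerAl -mpolyXD submK.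
Qed.

Lemma ideal_gen_ext (R : comNzRingType) (G H : R -> Prop) (x : R) :
  (forall y, G y <-> H y) -> ideal_gen G x <-> ideal_gen H x.
Proof.
by move=> GH; split=> -[s [Gs ->]]; exists s; split=> // q /Gs /GH.
Qed.

Lemma monomial_idealP us f :
  monomial_ideal K us f <->
  forall b, b \in msupp f -> exists2 u, u \in us & (u <= b)%MM.
Proof. exact: ideal_gen_msuppP. Qed.

Lemma mem_monomial_ideal us b :
  monomial_ideal K us 'X_[b] <-> exists2 u, u \in us & (u <= b)%MM.
Proof.
apply: iff_trans (monomial_idealP us _) _.
by split=> [H|H c]; [apply: H | ]; rewrite msuppX inE // => /eqP->.
Qed.

Lemma initial_idealP (I : {mpoly K[d]} -> Prop) f :
  initial_ideal I f <->
  forall b, b \in msupp f ->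
    exists2 a, (exists2 g, I g & is_lead_mnm g a) & (a <= b)%MM.
Proof.
apply: iff_trans (ideal_gen_msuppP _ _); apply: ideal_gen_ext => g.
by split=> [[h [a [Ih la ->]]]|[a [h Ih la] ->]];
  [exists a => //; exists h | exists h, a].
Qed.

Lemma colon_monomialP us u f :
  ideal_quotient (monomial_ideal K us) (monomial_ideal K [:: u]) f <->
  forall b, b \in msupp f -> exists2 v, v \in us & (v <= b + u)%MM.
Proof.
split=> [Hf b bf|Hf g /monomial_idealP gu].
  have /monomial_idealP : monomial_ideal K us (f * 'X_[u]).
    by apply: Hf; apply/mem_monomial_ideal; exists u; rewrite ?inE ?lepm_refl.
  by apply; rewrite mcoeff_msupp addmC mcoeffMX -mcoeff_msupp.
apply/monomial_idealP => b /msuppM_le /allpairsP[[c e] /= [cf eg ->]].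
have [v vus le_v] := Hf c cf; exists v => //; apply: lepm_trans le_v _.
have [_ /[!inE] /eqP-> le_ue] := gu e eg.
by apply/mnm_lepP => i; rewrite !mnmDE leq_add2l; apply/mnm_lepP.
Qed.

(** Each generator v of us contributes v / gcd(u, v) to the colon ideal.  The
    hypothesis says that some variable of the colon ideal divides it. *)
Lemma generated_by_variables_colon us u :
  (forall v, v \in us -> exists2 p : 'I_d, (u p < v p)%N &
     exists2 w, w \in us & (w <= U_(p) + u)%MM) ->
  generated_by_variables
    (ideal_quotient (monomial_ideal K us) (monomial_ideal K [:: u])).
Proof.
move=> H; pose V := [set p | has (fun w => w <= U_(p) + u)%MM us].
exists V => f.
have -> : ideal_gen (fun g => exists2 i, i \in V & g = 'X_i) f <->
    ideal_gen (fun g => exists2 v,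
      (exists2 i, i \in V & v = U_(i)%MM) & g = 'X_[v]) f.
  apply: ideal_gen_ext => g; split=> [[i iV ->]|[_ [i iV ->] ->]]; last by exists i.
  by exists U_(i)%MM => //; exists i.
apply: iff_trans (colon_monomialP _ _ _) _.
apply: iff_trans (iff_sym (ideal_gen_msuppP _ _)).
split=> Hf b /Hf[v].
  move=> /H[p lt_p [w wus le_w]] /mnm_lepP/(_ p) le_v; exists U_(p)%MM.
    by exists p => //; rewrite inE; apply/hasP; exists w.
  rewrite mnmDE in le_v; apply/mnm_lepP => j; rewrite mnm1E; case: eqP => // <-.
  by move: (leq_trans lt_p le_v); case: (b p) => //; rewrite add0n ltnn.
move=> [p + ->]; rewrite inE => /hasP[w wus le_w] le_p; exists w => //.
apply: lepm_trans le_w _; apply/mnm_lepP => i.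
by rewrite !mnmDE leq_add2r; apply/mnm_lepP.
Qed.

(** The order in which generators are listed: degree increasing, but lex
    decreasing within a degree (the graded order [<=] on exponents is lex when
    the degrees agree). *)
Definition earlier_eq v u :=
  (mdeg v < mdeg u)%N || ((mdeg v == mdeg u) && (u <= v)%O).

Lemma earlier_eq_total : total earlier_eq.
Proof. by move=> v u; rewrite /earlier_eq; case: ltngtP => //= _; apply: le_total. Qed.

Lemma earlier_eq_trans : transitive earlier_eq.
Proof.
move=> u v w; rewrite /earlier_eq.
case/orP=> [lt1|/andP[/eqP-> le1]] /orP[lt2|/andP[/eqP E2 le2]].
- by rewrite (ltn_trans lt1 lt2).
- by rewrite -E2 lt1.
- by rewrite lt2.
- by rewrite E2 eqxx (le_trans le2 le1) orbT.
Qed.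

Lemma earlier_eq_anti : antisymmetric earlier_eq.
Proof.
move=> v u; rewrite /earlier_eq eq_sym; case: ltngtP => //= _ le_uv.
by apply: le_anti; rewrite andbC.
Qed.

(** Since the order is total and antisymmetric, the generators before a given one
    in the sorted list are those that precede it in the order; positions in the list
    then disappear from the argument. *)
Lemma mem_take_sort us l v : let s := sort earlier_eq (undup us) in
  (l < size s)%N ->
  (v \in take l s) = [&& v \in us, v != nth 0%MM s l & earlier_eq v (nth 0%MM s l)].
Proof.
move=> s ltl; have us_s : uniq s by rewrite sort_uniq undup_uniq.
have s_sorted : sorted earlier_eq s by apply: sort_sorted; apply: earlier_eq_total.
have refl : reflexive earlier_eq by move=> w; rewrite /earlier_eq eqxx lexx orbT.
have -> : (v \in us) = (v \in s) by rewrite mem_sort mem_undup.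
have [vs|] := boolP (v \in s); last by apply: contraNF => /mem_take.
set u := nth _ _ _; have su : u \in s by apply: mem_nth.
have Eu : index u s = l by apply: index_uniq.
rewrite in_take //= -Eu; apply/idP/andP => [lt_vu|[neq le_vu]].
  split; first by apply: contraTneq lt_vu => ->; rewrite ltnn.
  exact: (sorted_ltn_index earlier_eq_trans s_sorted v u vs su lt_vu).
rewrite ltnNge; apply: contra neq => le_uv; apply/eqP/earlier_eq_anti.
by rewrite le_vu (sorted_leq_index earlier_eq_trans refl s_sorted u v su vs le_uv).
Qed.

(** Minimality of the generators is the antichain condition; linearity of the
    quotients is the exchange condition. *)
Lemma has_linear_quotients_exchange (I : {mpoly K[d]} -> Prop) us :
  ideal_eq I (monomial_ideal K us) ->
  {in us &, forall u w, (w <= u)%MM -> w = u} ->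
  {in us &, forall u v, v != u -> earlier_eq v u ->
     exists2 p : 'I_d, (u p < v p)%N &
     exists2 w, (w \in us) && earlier_eq w u & (w != u) && (w <= U_(p) + u)%MM} ->
  has_linear_quotients I.
Proof.
move=> EI anti exch; set s := sort earlier_eq (undup us).
have mem_s : s =i us by move=> u; rewrite mem_sort mem_undup.
have us_s : uniq s by rewrite sort_uniq undup_uniq.
exists s => [|l /andP[_ ltl]].
  split=> // [f|u su EIr].
    apply: iff_trans (EI f) _; apply: iff_trans (monomial_idealP _ _) _.
    apply: iff_trans (iff_sym (monomial_idealP _ _)).
    by split=> H b /H[v vs le_v]; exists v; rewrite // ?mem_s // -mem_s.
  have : I 'X_[u].
    by apply/EI/mem_monomial_ideal; exists u; rewrite ?lepm_refl // -mem_s.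
  move=> /EIr /mem_monomial_ideal[v]; rewrite mem_rem_uniq // inE.
  by case/andP=> /eqP neq; rewrite /= !mem_s in su * => vs /(anti _ _ su vs).
apply: generated_by_variables_colon => v; rewrite mem_take_sort // => /and3P[].
set u := nth _ _ _ => vus neq le_vu; have uus : u \in us by rewrite -mem_s mem_nth.
have [p lt_p [w /andP[wus le_w] /andP[neqw le]]] := exch u v uus vus neq le_vu.
by exists p => //; exists w => //; rewrite mem_take_sort // wus neqw.
Qed.
End MonomialIdeals.

(** * The path monomials and their exchange property *)

Section Generators.
Variables m n : nat.
Local Notation N := (m + n)%N.
Local Notation X i := (lshift N i).
Local Notation Y i := (rshift N i).
Implicit Types (i j k : 'I_N) (u v w a b c : 'X_{1..N + N}).

Definition bin_lead i j : 'X_{1..N + N} := (U_(X i) + U_(Y j))%MM.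

(** The three constructors are the admissible paths of the complete bipartite
    graph: an edge, and the two-edge paths i - k - j with i, j on one side, where
    admissibility puts k outside the interval from i to j.  An inner vertex k
    contributes x_k when it is larger than j and y_k when it is smaller than i. *)
Variant path_mnm : 'X_{1..N + N} -> Prop :=
| PathCross i j of (i < m <= j)%N : path_mnm (bin_lead i j)
| PathLeft i j k of (i < j < m)%N & (m <= k)%N :
    path_mnm (bin_lead i j + U_(X k))%MM
| PathRight i j k of (m <= i < j)%N & (k < m)%N :
    path_mnm (bin_lead i j + U_(Y k))%MM.

Definition path_mnms : seq 'X_{1..N + N} :=
  [seq bin_lead e.1 e.2
    | e : 'I_N * 'I_N <- enum {: 'I_N * 'I_N} & (e.1 < m <= e.2)%N] ++
  [seq (bin_lead e.1.1 e.1.2 + U_(X e.2))%MM |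
     e : 'I_N * 'I_N * 'I_N <- enum {: 'I_N * 'I_N * 'I_N}
     & (e.1.1 < e.1.2 < m)%N && (m <= e.2)%N] ++
  [seq (bin_lead e.1.1 e.1.2 + U_(Y e.2))%MM |
     e : 'I_N * 'I_N * 'I_N <- enum {: 'I_N * 'I_N * 'I_N}
     & (m <= e.1.1 < e.1.2)%N && (e.2 < m)%N].

Lemma path_mnmsP u : reflect (path_mnm u) (u \in path_mnms).
Proof.
rewrite !mem_cat; apply: (iffP idP) => [/or3P[]/mapP[e]|].
- by rewrite mem_filter => /andP[? _] ->; apply: PathCross.
- by rewrite mem_filter => /andP[/andP[? ?] _] ->; apply: PathLeft.
- by rewrite mem_filter => /andP[/andP[? ?] _] ->; apply: PathRight.
case=> [i j ij|i j k ij mk|i j k ij km]; apply/or3P.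
- by apply: Or31; apply/mapP; exists (i, j) => //; rewrite mem_filter mem_enum /= ij.
- by apply: Or32; apply/mapP; exists (i, j, k) => //; rewrite mem_filter mem_enum /= ij mk.
- by apply: Or33; apply/mapP; exists (i, j, k) => //; rewrite mem_filter mem_enum /= ij km.
Qed.

Lemma bin_leadE i j p : bin_lead i j p = ((X i == p) + (Y j == p))%N.
Proof. by rewrite mnmDE !mnm1E. Qed.

Lemma mdeg_bin_lead i j : mdeg (bin_lead i j) = 2.
Proof. by rewrite mdegD !mdeg1. Qed.

Let coordE := (bin_leadE, @mnmDE (N + N), @mnm1E (N + N), eq_lshift, eq_rshift,
  eq_lrshift, eq_rlshift).
Let degE := (@mdegD (N + N), mdeg_bin_lead, @mdeg1 (N + N)).

Lemma path_mnm_antichain u w :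
  path_mnm u -> path_mnm w -> (w <= u)%MM -> w = u.
Proof.
move=> pu pw le_wu; have [/(lem_mdeg_eq le_wu) //|] := leqP (mdeg u) (mdeg w).
have deg_u : (mdeg u <= 3)%N by case: pu => *; rewrite !degE.
case: pw le_wu => [i j /andP[im mj]|i j k _ _|i j k _ _] le_wu; last 2 first.
- by rewrite !degE ltnNge deg_u.
- by rewrite !degE ltnNge deg_u.
move/mnm_lepP: le_wu => le_wu.
case: pu le_wu => [i' j' _|i' j' k' /andP[_ jm] _|i' j' k' /andP[mi _] _] le_wu.
- by rewrite !degE.
- move: (le_wu (Y j)); rewrite !coordE eqxx.
  by case: eqP jm => // ->; rewrite ltnNge mj.
- move: (le_wu (X i)); rewrite !coordE eqxx.
  by case: eqP mi => // ->; rewrite leqNgt im.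
Qed.

(** The exchange condition of the criterion for linear quotients. *)
Definition exchangeable u v := exists2 p : 'I_(N + N), (u p < v p)%N &
  exists2 w, (w \in path_mnms) && earlier_eq w u &
             (w != u) && (w <= U_(p) + u)%MM.

(** A generator of smaller degree precedes u, whatever its lex position. *)
Lemma exchange_divide u v w (p : 'I_(N + N)) :
  (u p < v p)%N -> path_mnm w -> (mdeg w < mdeg u)%N -> (w <= U_(p) + u)%MM ->
  exchangeable u v.
Proof.
move=> lt_p /path_mnmsP pw lt_wu le_w; exists p => //; exists w.
  by rewrite pw /earlier_eq lt_wu.
by rewrite le_w andbT; apply: contraTneq lt_wu => ->; rewrite ltnn.
Qed.

(** Replacing the variable q of u by a larger variable p makes the monomial lex
    larger, hence earlier. *)
Lemma exchange_swap c v (p q : 'I_(N + N)) :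
  ((U_(q) + c)%MM p < v p)%N -> (p < q)%N -> path_mnm (U_(p) + c)%MM ->
  exchangeable (U_(q) + c)%MM v.
Proof.
move=> lt_p lt_pq /path_mnmsP pw; exists p => //; exists (U_(p) + c)%MM.
  rewrite pw /earlier_eq !degE eqxx ltnn /= lemc_add2l ltW //.
  apply/ltmcP; rewrite ?mdeg1 //; exists p => [r lt_rp|]; rewrite !mnm1E.
    have -> : (q == r) = false by rewrite -val_eqE gtn_eqF // (ltn_trans lt_rp).
    by rewrite -val_eqE gtn_eqF.
  by rewrite eqxx -val_eqE gtn_eqF.
apply/andP; split.
  apply: contraTneq lt_pq => /addIm/(congr1 (fun u : 'X_{1..N+N} => u p)).
  by rewrite !mnm1E eqxx; case: eqP => // ->; rewrite ltnn.
by rewrite addmA; apply/mnm_lepP=> r; rewrite !mnmDE leq_add2r leq_addr.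
Qed.

Lemma right_neq_left k i : (m <= k)%N -> (i < m)%N -> (k == i) = false.
Proof. by move=> mk im; rewrite -val_eqE gtn_eqF // (leq_trans im). Qed.

Lemma left_neq_right k i : (m <= k)%N -> (i < m)%N -> (i == k) = false.
Proof. by move=> mk im; rewrite eq_sym right_neq_left. Qed.

(** For u and v of equal degree, this says that v is lex larger than u, p being
    the first variable where they differ. *)
Definition first_excess u v (p : 'I_(N + N)) :=
  (forall q : 'I_(N + N), (q < p)%N -> u q = v q) /\ (u p < v p)%N.

(** If q occurs in u but not in v then q comes after the first difference p, so
    that replacing q by p moves u earlier.  Only membership of the new monomial in
    the generators remains to be checked, and p < q helps there. *)
Lemma exchange_first u v p q c :
  first_excess u v p -> u = (U_(q) + c)%MM -> v q = 0%N ->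
  ((p < q)%N -> path_mnm (U_(p) + c)%MM) -> exchangeable u v.
Proof.
move=> [agree lt_p] Eu vq pw; have uq : (0 < u q)%N by rewrite Eu mnmDE mnm1E eqxx.
have lt_pq : (p < q)%N.
  rewrite ltn_neqAle leqNgt; apply/andP; split.
    by apply: contraTneq lt_p => /val_inj->; rewrite vq.
  by apply: contraTN uq => /agree->; rewrite vq.
by rewrite Eu in lt_p *; apply: exchange_swap lt_p lt_pq (pw lt_pq).
Qed.

(** In each of the three shapes, p is one of the variables of v, and q is the
    variable of u playing the same role. *)
Lemma exchange_cross i j i' j' p :
  (i < m <= j)%N -> (i' < m <= j')%N ->
  first_excess (bin_lead i j) (bin_lead i' j') p ->
  exchangeable (bin_lead i j) (bin_lead i' j').
Proof.
move=> /andP[im mj] /andP[im' mj'] Hp; have [_ lt_p] := Hp.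
have /orP[/eqP Ep|/eqP Ep] : (X i' == p) || (Y j' == p).
  by move: (leq_ltn_trans (leq0n _) lt_p); rewrite bin_leadE addn_gt0 !lt0b.
- apply: (exchange_first (q := X i) (c := U_(Y j)%MM) Hp) => //; subst p.
    move: lt_p; rewrite !coordE eqxx eq_sym.
    by case: eqP.
  by move=> _; apply: PathCross; rewrite im'.
- apply: (exchange_first (q := Y j) (c := U_(X i)%MM) Hp); subst p.
  + by rewrite addmC.
  + by move: lt_p; rewrite !coordE eqxx eq_sym; case: eqP.
  + by move=> _; rewrite addmC; apply: PathCross; rewrite im.
Qed.

Lemma exchange_left i j k i' j' k' p :
  (i < j < m)%N -> (m <= k)%N -> (i' < j' < m)%N -> (m <= k')%N ->
  first_excess (bin_lead i j + U_(X k))%MM (bin_lead i' j' + U_(X k'))%MM p ->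
  exchangeable (bin_lead i j + U_(X k))%MM (bin_lead i' j' + U_(X k'))%MM.
Proof.
move=> /andP[ij jm] mk /andP[ij' jm'] mk' Hp; have [agree lt_p] := Hp.
have im := ltn_trans ij jm; have im' := ltn_trans ij' jm'.
have /orP[/orP[]|] : (X i' == p) || (Y j' == p) || (X k' == p).
- by move: (leq_ltn_trans (leq0n _) lt_p); rewrite mnmDE bin_leadE mnm1E !addn_gt0 !lt0b.
- move=> /eqP Ep; apply: (exchange_first (q := X i) (c := (U_(Y j) + U_(X k))%MM) Hp).
  + by rewrite addmA.
  + subst p; move: lt_p; rewrite !coordE eqxx (right_neq_left mk im').
    rewrite (right_neq_left mk' im) (right_neq_left mk' im') eq_sym.
    by case: eqP.
  + by subst p => lt_i; rewrite addmA; apply: PathLeft; rewrite // jm (ltn_trans lt_i).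
- move=> /eqP Ep; apply: (exchange_first (q := Y j) (c := (U_(X i) + U_(X k))%MM) Hp).
  + by rewrite addmA [(U_(Y j) + _)%MM]addmC.
  + by subst p; move: lt_p; rewrite !coordE eqxx eq_sym; case: eqP.
  + subst p => lt_j; rewrite addmA [(U_(Y _) + _)%MM]addmC; apply: PathLeft => //.
    (* v agrees with u at x_i', so i = i' and the inequality i < j' holds *)
    have := agree (X i') (leq_trans (ltn_ord _) (leq_addr _ _)).
    rewrite !coordE eqxx (right_neq_left mk im'); case: eqP => // -> _.
    by rewrite ij'.
- move=> /eqP Ep; apply: (exchange_first (q := X k) (c := bin_lead i j) Hp).
  + by rewrite addmC.
  + subst p; move: lt_p; rewrite !coordE eqxx (left_neq_right mk' im).
    by rewrite (left_neq_right mk im') (left_neq_right mk' im') eq_sym; case: eqP.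
  + by subst p => _; rewrite addmC; apply: PathLeft; rewrite ?ij.
Qed.

Lemma exchange_right i j k i' j' k' p :
  (m <= i < j)%N -> (k < m)%N -> (m <= i' < j')%N -> (k' < m)%N ->
  first_excess (bin_lead i j + U_(Y k))%MM (bin_lead i' j' + U_(Y k'))%MM p ->
  exchangeable (bin_lead i j + U_(Y k))%MM (bin_lead i' j' + U_(Y k'))%MM.
Proof.
move=> /andP[mi ij] km /andP[mi' ij'] km' Hp; have [agree lt_p] := Hp.
have mj := leq_trans mi (ltnW ij); have mj' := leq_trans mi' (ltnW ij').
have /orP[/orP[]|] : (X i' == p) || (Y j' == p) || (Y k' == p).
- by move: (leq_ltn_trans (leq0n _) lt_p); rewrite mnmDE bin_leadE mnm1E !addn_gt0 !lt0b.
- move=> /eqP Ep; apply: (exchange_first (q := X i) (c := (U_(Y j) + U_(Y k))%MM) Hp).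
  + by rewrite addmA.
  + by subst p; move: lt_p; rewrite !coordE eqxx eq_sym; case: eqP.
  + by subst p => lt_i; rewrite addmA; apply: PathRight; rewrite // mi' (ltn_trans lt_i).
- move=> /eqP Ep; apply: (exchange_first (q := Y j) (c := (U_(X i) + U_(Y k))%MM) Hp).
  + by rewrite addmA [(U_(Y j) + _)%MM]addmC.
  + subst p; move: lt_p; rewrite !coordE eqxx (left_neq_right mj' km).
    rewrite (left_neq_right mj km') (left_neq_right mj' km') eq_sym.
    by case: eqP.
  + subst p => lt_j; rewrite addmA [(U_(Y _) + _)%MM]addmC; apply: PathRight => //.
    (* v agrees with u at x_i', so i = i' and the inequality i < j' holds *)
    have := agree (X i') (leq_trans (ltn_ord _) (leq_addr _ _)).
    by rewrite !coordE eqxx; case: eqP => // -> _; rewrite mi'.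
- move=> /eqP Ep; apply: (exchange_first (q := Y k) (c := bin_lead i j) Hp).
  + by rewrite addmC.
  + subst p; move: lt_p; rewrite !coordE eqxx (right_neq_left mj km').
    by rewrite (right_neq_left mj' km) (right_neq_left mj' km') eq_sym; case: eqP.
  + by subst p => _; rewrite addmC; apply: PathRight; rewrite ?mi.
Qed.

Lemma path_mnm_exchange u v :
  path_mnm u -> path_mnm v -> v != u -> earlier_eq v u -> exchangeable u v.
Proof.
move=> pu pv neq; rewrite /earlier_eq le_eqVlt [u == v]eq_sym (negbTE neq) /= => le_vu.
have fe : mdeg v = mdeg u -> exists p, first_excess u v p.
  move=> Edeg; move: le_vu; rewrite Edeg ltnn eqxx /=.
  by case/ltmcP=> // p agree lt_p; exists p.
have {}le_vu : (mdeg v <= mdeg u)%N by case: ltngtP le_vu.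
case: pu pv neq le_vu fe.
- move=> i j ij [i' j' ij'|i' j' k' _ _|i' j' k' _ _] _; rewrite !degE //.
  by move=> _ [//|p /exchange_cross]; apply.
- move=> i j k ij mk; have /andP[lt_ij jm] := ij.
  have divY i' j' c : (m <= j')%N ->
      exchangeable (bin_lead i j + U_(X k))%MM (bin_lead i' j' + c)%MM.
    move=> mj'; apply: (@exchange_divide _ _ (bin_lead i j') (Y j')).
    + by rewrite !coordE eqxx left_neq_right //; lia.
    + by apply: PathCross; rewrite (ltn_trans lt_ij jm).
    + by rewrite !degE.
    + by apply/mnm_lepP => r; rewrite !(bin_leadE, mnmDE, mnm1E); lia.
  case=> [i' j' /andP[_ mj']|i' j' k' ij' mk'|i' j' k' /andP[mi' lt_ij'] km'] _.
  + by move=> _ _; rewrite -[bin_lead i' j']addm0; apply: divY.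
  + by rewrite !degE => _ [//|p /exchange_left]; apply.
  + by move=> _ _; apply: divY; apply: leq_trans mi' (ltnW _).
- move=> i j k ij km; have /andP[mi lt_ij] := ij.
  have divX i' j' c : (i' < m)%N ->
      exchangeable (bin_lead i j + U_(Y k))%MM (bin_lead i' j' + c)%MM.
    move=> im'; apply: (@exchange_divide _ _ (bin_lead i' j) (X i')).
    + by rewrite !coordE eqxx right_neq_left //; lia.
    + by apply: PathCross; rewrite im' (leq_trans mi (ltnW _)).
    + by rewrite !degE.
    + by apply/mnm_lepP => r; rewrite !(bin_leadE, mnmDE, mnm1E); lia.
  case=> [i' j' /andP[im' _]|i' j' k' /andP[lt_ij' jm'] mk'|i' j' k' ij' km'] _.
  + by move=> _ _; rewrite -[bin_lead i' j']addm0; apply: divX.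
  + by move=> _ _; apply: divX; apply: ltn_trans jm'.
  + by rewrite !degE => _ [//|p /exchange_right]; apply.
Qed.
End Generators.

(** * Fibres of the Segre substitution *)

Section SegreMap.
Variables (K : fieldType) (N : nat).
Local Notation X i := (lshift N i).
Local Notation Y i := (rshift N i).
Implicit Types (i j : 'I_N) (a b : 'X_{1..N + N}) (f g : {mpoly K[N + N]}).

Definition vertex_deg b i := (b (X i) + b (Y i))%N.

(** The exponents of t_i are indexed by the successors and that of s by 0.  Giving
    y_i the image t_i rather than a multiple of a further variable loses nothing, as
    the total degree is determined by the degrees in the t_i. *)
Definition segre_mnm b : 'X_{1..N.+1} :=
  [multinom oapp (vertex_deg b) (\sum_j b (X j))%N (unlift ord0 r) | r < N.+1].

Definition segre : {mpoly K[N + N]} -> {mpoly K[N.+1]} :=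
  mmap (@mpolyC N.+1 K) (fun p => 'X_[segre_mnm U_(p)]).

HB.instance Definition _ := GRing.RMorphism.on segre.

Lemma segre_mnm0 : segre_mnm 0 = 0%MM.
Proof.
apply/mnmP => r; rewrite mnmE mnm0E; case: unliftP => [j _|_] /=.
  by rewrite /vertex_deg !mnm0E.
by rewrite big1 // => j _; rewrite mnm0E.
Qed.

Lemma segre_mnmD a b : segre_mnm (a + b) = (segre_mnm a + segre_mnm b)%MM.
Proof.
apply/mnmP => r; rewrite mnmDE !mnmE; case: unliftP => [j _|_] /=.
  by rewrite /vertex_deg !mnmDE addnACA.
by rewrite -big_split /=; apply: eq_bigr => j _; rewrite mnmDE.
Qed.

Lemma segreX b : segre 'X_[b] = 'X_[segre_mnm b].
Proof.
rewrite /segre mmapX /mmap1 mprodXnE {2}(multinomUE_id b).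
congr 'X_[_]; rewrite (big_morph _ segre_mnmD segre_mnm0).
apply: eq_bigr => p _; elim: (b p) => [|e IH]; first by rewrite !mulm0n segre_mnm0.
by rewrite !mulmS segre_mnmD IH.
Qed.

Lemma mcoeff_segre f c :
  (segre f)@_c = \sum_(b <- msupp f | segre_mnm b == c) f@_b.
Proof.
rewrite /segre /mmap raddf_sum [RHS]big_mkcond; apply: eq_bigr => b _ /=.
rewrite mcoeffCM -(mmapX _ (@mpolyC N.+1 K)) -/(segre _) segreX mcoeffX.
by case: eqP => _; rewrite ?mulr1 ?mulr0.
Qed.

Lemma segre_edge_binomial i j : segre (xvar K i * yvar K j - xvar K j * yvar K i) = 0.
Proof.
rewrite rmorphB !rmorphM /= !segreX -!mpolyXD -!segre_mnmD; apply/eqP.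
rewrite subr_eq0; apply/eqP; congr 'X_[_]; apply/mnmP => r.
rewrite !mnmE; case: unliftP => [k _|_] /=.
  rewrite /vertex_deg !mnmDE !mnm1E !eq_lrshift !eq_rlshift !eq_lshift !eq_rshift.
  by rewrite !addn0 !add0n addnC.
have sumX k : (\sum_l U_(X k)%MM (X l) = 1)%N.
  rewrite (bigD1 k) //= mnm1E eqxx big1 ?addn0 // => l neq.
  by rewrite mnm1E eq_lshift eq_sym (negbTE neq).
have sumY k : (\sum_l U_(Y k)%MM (X l) = 0)%N.
  by rewrite big1 // => l _; rewrite mnm1E eq_rlshift.
have sumD a b : (\sum_l (a + b)%MM (X l) = \sum_l a (X l) + \sum_l b (X l))%N.
  by rewrite -big_split; apply: eq_bigr => l _; rewrite mnmDE.
by rewrite !sumD !sumX !sumY.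
Qed.

(** Only the lex smallest monomial of a fibre is free of every x_i y_j with
    i < j.  At the first variable where b is smaller than a, which must be some x_i
    because the y-part is determined by the x-part in a fibre, the deficit of b in
    x-degree has to be compensated at some later x_j; then a has a positive
    exponent at y_j. *)
Lemma segre_fibre_lex a b : segre_mnm b = segre_mnm a -> mnm_lex b a ->
  exists i j, [/\ (i < j)%N, (0 < a (X i))%N & (0 < a (Y j))%N].
Proof.
move=> /mnmP Eab /mnm_lexP[p agree lt_p].
have Evd i : vertex_deg b i = vertex_deg a i.
  by have := Eab (lift ord0 i); rewrite !mnmE liftK.
have Etot : (\sum_j b (X j) = \sum_j a (X j))%N.
  by have := Eab ord0; rewrite !mnmE unlift_none.
case: (split_ordP p) => i Ep; subst p; last first.
  have Ex : b (X i) = a (X i) by apply: agree; rewrite /= ltn_addr.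
  by have := Evd i; rewrite /vertex_deg Ex => /addnI Ey; rewrite Ey ltnn in lt_p.
have [j lt_j] : exists j, (a (X j) < b (X j))%N.
  apply/existsP; apply: contraT; rewrite negb_exists => /forallP le_ba.
  have : (\sum_(j | j != i) b (X j) <= \sum_(j | j != i) a (X j))%N.
    by apply: leq_sum => j _; rewrite leqNgt.
  by move: Etot; rewrite (bigD1 i) //= [RHS](bigD1 i) //=; lia.
exists i, j; split.
- have [//|lt_ji|/val_inj Eij] := ltngtP i j.
    by rewrite agree // ltnn in lt_j.
  by move: lt_p; rewrite Eij ltnNge ltnW.
- exact: leq_ltn_trans lt_p.
- by have := Evd j; rewrite /vertex_deg; lia.
Qed.

(** If the leading monomial of f were alone in its fibre, its coefficient would
    survive in the image of f. *)
Lemma segre_kernel_lead f a : segre f = 0 -> is_lead_mnm f a ->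
  exists i j, [/\ (i < j)%N, (0 < a (X i))%N & (0 < a (Y j))%N].
Proof.
move=> f0 [af lead_a].
have [/hasP[b bf /andP[neq /eqP Eb]]|/hasPn alone] :=
  boolP (has (fun b => (b != a) && (segre_mnm b == segre_mnm a)) (msupp f)).
  by apply: segre_fibre_lex Eb _; apply: lead_a.
have := mcoeff_segre f (segre_mnm a); rewrite f0 mcoeff0 big_mkcond.
rewrite (bigD1_seq a) ?msupp_uniq //= eqxx big1_seq ?addr0 => [/esym/eqP|b].
  by rewrite mcoeff_eq0 af.
by case/andP => neq /alone; rewrite neq /= => /negbTE->.
Qed.
End SegreMap.

(** * The initial ideal of the binomial edge ideal *)

Section InitialIdeal.
Variables (K : fieldType) (m n : nat).
Local Notation N := (m + n)%N.
Local Notation X i := (lshift N i).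
Local Notation Y i := (rshift N i).
Local Notation J := (binomial_edge_ideal K (complete_bipartite m n)).
Implicit Types (i j k : 'I_N) (a b c : 'X_{1..N + N}) (f g : {mpoly K[N + N]}).

Definition edge_binomial i j : {mpoly K[N + N]} :=
  xvar K i * yvar K j - xvar K j * yvar K i.

Lemma edge_binomialE i j :
  edge_binomial i j = 'X_[bin_lead i j] - 'X_[bin_lead j i].
Proof. by rewrite /bin_lead !mpolyXD. Qed.

Lemma complete_bipartite_adj i j :
  (i < j)%N -> complete_bipartite m n i j = (i < m <= j)%N.
Proof.
move=> ij; apply/orP/idP => [[//|/andP[jm mi]]|]; last by left.
by have := leq_trans (ltn_trans ij jm) mi; rewrite ltnn.
Qed.

Lemma binomial_edge_segre f : J f -> segre f = 0.
Proof.
case=> s [Js ->]; rewrite raddf_sum big1_seq //= => q /Js[i [j [_ _ Eq]]].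
by rewrite rmorphM /= Eq segre_edge_binomial mulr0.
Qed.

(** Every edge joins the two sides, so both terms of each generator, and all their
    multiples, meet both sides. *)
Lemma binomial_edge_mixed f b : J f -> b \in msupp f -> exists i j,
  [/\ (i < m <= j)%N, (0 < vertex_deg b i)%N & (0 < vertex_deg b j)%N].
Proof.
case=> s [Js ->] /msupp_sum_le /flattenP[_ /mapP[q + ->]].
rewrite mem_filter /= => /Js[i [j [adj_ij ij Eq]]].
move=> /msuppM_le /allpairsP[[c e] /= [_ + ->]].
rewrite Eq -/(edge_binomial i j) edge_binomialE => /msuppB_le.
rewrite mem_cat !msuppX !inE => Ee; exists i, j.
rewrite complete_bipartite_adj // in adj_ij.
split=> //; case/orP: Ee => /eqP->; rewrite /vertex_deg !(mnmDE, bin_leadE) !eqxx; lia.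
Qed.

Lemma bin_lead_lem a i j :
  (0 < a (X i))%N -> (0 < a (Y j))%N -> (bin_lead i j <= a)%MM.
Proof.
move=> ai aj; apply: lem_addU aj; last by rewrite mnm1E eq_lrshift.
by apply/mnm_lepP => r; rewrite mnm1E; case: eqP => // <-.
Qed.

(** The leading monomial a has x_i y_j with i < j and meets both sides, at l and r.
    When i and j are on the left, y_r makes x_i y_r a generator and x_r makes
    x_i x_r y_j one; the right side is symmetric. *)
Lemma path_mnm_lead f a : J f -> is_lead_mnm f a ->
  exists2 u, path_mnm u & (u <= a)%MM.
Proof.
move=> Jf lead_a; have [af _] := lead_a.
have [i [j [ij ai aj]]] := segre_kernel_lead (binomial_edge_segre Jf) lead_a.
have [l [r [/andP[lm mr] al ar]]] := binomial_edge_mixed Jf af.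
have cross i' j' : (i' < m)%N -> (m <= j')%N -> (0 < a (X i'))%N ->
    (0 < a (Y j'))%N -> exists2 u, path_mnm u & (u <= a)%MM.
  move=> im mj ai' aj'; exists (bin_lead i' j'); last exact: bin_lead_lem.
  by apply: PathCross; rewrite im.
have [im|mi] := ltnP i m; have [jm|mj] := ltnP j m.
- have [yr0|] := posnP (a (Y r)); last by apply: (cross i r).
  exists (bin_lead i j + U_(X r))%MM; first by apply: PathLeft; rewrite ?ij.
  apply: lem_addU; first exact: bin_lead_lem.
    by rewrite bin_leadE eq_rlshift eq_lshift (left_neq_right mr im).
  by move: ar; rewrite /vertex_deg yr0 addn0.
- exact: (cross i j).
- by have := leq_trans (ltn_trans ij jm) mi; rewrite ltnn.
- have [xl0|] := posnP (a (X l)); last by move=> xl; apply: (cross l j).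
  exists (bin_lead i j + U_(Y l))%MM; first by apply: PathRight; rewrite ?mi.
  apply: lem_addU; first exact: bin_lead_lem.
    by rewrite bin_leadE eq_lrshift eq_rshift (right_neq_left mj lm).
  by move: al; rewrite /vertex_deg xl0.
Qed.

(** Whatever the cofactor c, the two terms first differ at x_i. *)
Lemma edge_binomial_lead i j c : (i < j)%N ->
  is_lead_mnm (edge_binomial i j * 'X_[c]) (bin_lead i j + c)%MM.
Proof.
move=> ij; have lex : mnm_lex (bin_lead j i + c)%MM (bin_lead i j + c)%MM.
  have ltX (p : 'I_(N + N)) k : (p < k)%N -> (X k == p) = false.
    by move=> pk; rewrite -val_eqE gtn_eqF.
  have ltY (p : 'I_(N + N)) k : (p < N)%N -> (Y k == p) = false.
    by move=> pN; rewrite -val_eqE gtn_eqF //= (leq_trans pN) // leq_addr.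
  apply/mnm_lexP; exists (X i) => [p pi|].
    have pN : (p < N)%N := ltn_trans pi (ltn_ord i).
    by rewrite !(bin_leadE, @mnmDE (N + N)) !ltX ?ltY // (ltn_trans pi).
  rewrite mnmDE [ltnRHS]mnmDE ltn_add2r !bin_leadE !eq_rlshift !eq_lshift eqxx.
  by rewrite -val_eqE gtn_eqF.
have neq : (bin_lead j i + c == bin_lead i j + c)%MM = false.
  by apply: contraTF lex => /eqP->; rewrite /mnm_lex ltxx.
rewrite edge_binomialE mulrBl -!mpolyXD; split=> [|b /msuppB_le].
  by rewrite mcoeff_msupp mcoeffB !mcoeffX eqxx neq subr0 oner_eq0.
by rewrite mem_cat !msuppX !inE => /orP[->//|/eqP->].
Qed.

Lemma binomial_edge_ideal_comb (p q : {mpoly K[N + N]}) i j k (l : 'I_N) :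
  (i < m <= j)%N -> (k < m <= l)%N ->
  J (p * edge_binomial i j + q * edge_binomial k l).
Proof.
move=> ij kl; exists [:: (p, edge_binomial i j); (q, edge_binomial k l)].
split=> [e|]; last by rewrite !big_cons big_nil addr0.
have lt_of i' j' : (i' < m <= j')%N -> (i' < j')%N.
  by case/andP; apply: leq_trans.
rewrite !inE => /orP[]/eqP->; [exists i, j | exists k, l];
  by split; rewrite ?complete_bipartite_adj ?lt_of.
Qed.

(** The syzygies that put the cubic path binomials into J: a 2-minor of columns
    i, j times an entry of column k is a combination of the minors through k. *)
Lemma minor_three_term (R : comNzRingType) (xi yi xj yj xk yk : R) :
  ((xi * yj - xj * yi) * xk =
     xj * (xi * yk - xk * yi) + - xi * (xj * yk - xk * yj)) *
  ((xi * yj - xj * yi) * yk =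
     yi * (xk * yj - xj * yk) + - yj * (xk * yi - xi * yk)).
Proof. by split; ring. Qed.

Lemma path_mnm_initial u : path_mnm u -> exists2 f, J f & is_lead_mnm f u.
Proof.
case=> [i j ij|i j k /andP[ij jm] mk|i j k /andP[mi ij] km].
- exists (edge_binomial i j * 'X_[0]).
    have := binomial_edge_ideal_comb 1 0 ij ij.
    by rewrite mpolyX0 mulr1 mul1r mul0r addr0.
  rewrite -[bin_lead i j]addm0; apply: edge_binomial_lead.
  by case/andP: ij; apply: leq_trans.
- exists (edge_binomial i j * 'X_[U_(X k)]); last exact: edge_binomial_lead.
  have -> : edge_binomial i j * 'X_[U_(X k)] =
      xvar K j * edge_binomial i k + - xvar K i * edge_binomial j k.
    exact: (minor_three_term _ _ _ _ (xvar K k) (yvar K k)).1.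
  by apply: binomial_edge_ideal_comb; rewrite ?jm ?(ltn_trans ij jm).
- exists (edge_binomial i j * 'X_[U_(Y k)]); last exact: edge_binomial_lead.
  have -> : edge_binomial i j * 'X_[U_(Y k)] =
      yvar K i * edge_binomial k j + - yvar K j * edge_binomial k i.
    exact: (minor_three_term _ _ _ _ (xvar K k) (yvar K k)).2.
  by apply: binomial_edge_ideal_comb; rewrite km ?(leq_trans mi (ltnW ij)) ?mi.
Qed.

Lemma initial_ideal_path_mnms :
  ideal_eq (initial_ideal J) (monomial_ideal K (path_mnms m n)).
Proof.
move=> f; apply: iff_trans (initial_idealP _ _) _.
apply: iff_trans (iff_sym (monomial_idealP _ _)).
split=> H b /H[a].
  case=> g Jg /(path_mnm_lead Jg)[u /path_mnmsP pu le_ua] le_ab.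
  by exists u => //; apply: lepm_trans le_ab.
by move=> /path_mnmsP /path_mnm_initial[g Jg lead_g] le_ab; exists a => //; exists g.
Qed.
End InitialIdeal.

Theorem proposition2p1 (K : fieldType) (m n : nat) (hn : (1 <= n)%N) (hmn : (n <= m)%N) :
  has_linear_quotients
    (initial_ideal (binomial_edge_ideal K (complete_bipartite m n))).
Proof.
apply: (has_linear_quotients_exchange (@initial_ideal_path_mnms K m n)).
  by move=> u w /path_mnmsP pu /path_mnmsP pw; apply: path_mnm_antichain.
by move=> u v /path_mnmsP pu /path_mnmsP pv; apply: path_mnm_exchange.
Qed.
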